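(* Let $\mathbb{F}_q$ be a finite field and let $1\le k\le n-k$. Let $R_{ij}$, $0\le i,j\le k$, be the matrix of the Radon transform $\mathcal{R}$ of type $\lambda=(k,n-k)$ acting on the Hecke algebra $\mathcal{H}(GL_n(\mathbb{F}_q),P_{(k,n-k)})$ in the basis $e_0,\dots,e_k$. Then the eigenvalues of the matrix $(R_{ij})$ are $$q^{k(n-k)-k+(n-2k+1)t+t^2},\qquad 0\le t\le k.$$
   Context: Let $\lambda=(k,n-k)$. $P_\lambda\subset GL_n(\mathbb{F}_q)$ is the group of invertible block upper triangular matrices with diagonal blocks of sizes $k$ and $n-k$; $U_\lambda\subset P_\lambda$ is the subgroup where the diagonal blocks are identity matrices; $U_\lambda^{op}$ is the group of transposes of elements of $U_\lambda$. For a subgroup $H$ of a finite group $G$, $e_H=\frac{1}{|H|}\sum_{h\in H}h\in\mathbb{C}[G]$ and $\mathcal{H}(G,H)=e_H\mathbb{C}[G]e_H$. The Radon element is $\mathcal{R}=|U_\lambda|^2e_{U_\lambda}e_{U_\lambda^{op}}e_{U_\lambda}$. For $0\le i\le k$ let $p_i$ be the permutation matrix which, with rows and columns divided into consecutive blocks of sizes $k-i,\ i,\ i,\ n-k-i$, is $$p_i=\begin{pmatrix}1&0&0&0\\0&0&1&0\\0&1&0&0\\0&0&0&1\end{pmatrix}$$ (where $1$ denotes an identity block), and let $e_i=e_{P_\lambda}p_ie_{P_\lambda}$. The elements $e_0,\dots,e_k$ form a basis of $\mathcal{H}(GL_n(\mathbb{F}_q),P_\lambda)$. The action of the Radon transform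 on $\mathcal{H}(GL_n(\mathbb{F}_q),P_\lambda)$ is $e_i\mapsto |U_\lambda|^2\, e_{P_\lambda}p_i\,e_{U_\lambda}e_{U_\lambda^{op}}\,e_{P_\lambda}=\sum_{u\in U_\lambda,\,\bar u\in U_\lambda^{op}}e_{P_\lambda}p_iu\bar u\,e_{P_\lambda}$ (i.e. right multiplication by $\mathcal{R}$), and $R_{ij}$ is defined by $e_i\mapsto\sum_{j=0}^kR_{ij}e_j$. *)

(* Defs.v *)
From HB Require Import structures.
From mathcomp Require Import all_boot all_order all_fingroup all_algebra.
From mathcomp Require Import mxrepresentation.

Set Implicit Arguments.
Unset Strict Implicit.
Unset Printing Implicit Defensive.

Import GroupScope GRing.Theory.
Local Open Scope ring_scope.

(* {'GL_n[F]} is the group of units of 'M[F]_n.-1.+1, which is 'M[F]_n as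
   soon as 0 < n.  Indices start at 0: for lambda = (k, n - k) the first
   diagonal block consists of the indices < k.                               *)

Definition parabolic (F : finFieldType) (n k : nat) : {set {'GL_n[F]}} :=
  [set g : {'GL_n[F]} | [forall a : 'I_n.-1.+1, forall b : 'I_n.-1.+1,
     (b < k <= a)%N ==> (GLval g a b == 0)]].

Definition unipotent (F : finFieldType) (n k : nat) : {set {'GL_n[F]}} :=
  [set g in parabolic F n k | [forall a : 'I_n.-1.+1, forall b : 'I_n.-1.+1,
     ((a < k)%N == (b < k)%N) ==> (GLval g a b == (a == b)%:R)]].

Definition unipotent_op (F : finFieldType) (n k : nat) : {set {'GL_n[F]}} :=
  [set g : {'GL_n[F]} | GLval g \in [set (GLval u)^T | u in unipotent F n k]].

Lemma parabolicP (F : finFieldType) (n k : nat) (g : {'GL_n[F]}) :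
  reflect (forall a b : 'I_n.-1.+1, (b < k)%N -> (k <= a)%N -> GLval g a b = 0)
          (g \in parabolic F n k).
Proof.
rewrite inE; apply: (iffP forallP) => [h a b ltb lea | h a].
  by have /forallP/(_ b) := h a; rewrite ltb lea => /eqP.
by apply/forallP => b; apply/implyP => /andP[ltb lea]; apply/eqP; apply: h.
Qed.

Lemma unipotentP (F : finFieldType) (n k : nat) (g : {'GL_n[F]}) :
  reflect (g \in parabolic F n k /\
           forall a b : 'I_n.-1.+1, (a < k)%N = (b < k)%N ->
             GLval g a b = (a == b)%:R)
          (g \in unipotent F n k).
Proof.
rewrite [_ \in unipotent _ _ _]inE; apply: (iffP andP) => -[Pg h]; split=> //.
  move=> a b eab; move/forallP: h => /(_ a)/forallP/(_ b).
  by rewrite eab eqxx => /eqP.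
apply/forallP => a; apply/forallP => b; apply/implyP => /eqP eab.
by apply/eqP; apply: h.
Qed.

Lemma parabolic_group_set (F : finFieldType) (n k : nat) :
  group_set (parabolic F n k).
Proof.
apply/group_setP; split=> [|g h /parabolicP Pg /parabolicP Ph].
  apply/parabolicP=> a b ltb lea; rewrite GL_1E mxE; case: eqP => // eab.
  by move: lea; rewrite eab leqNgt ltb.
apply/parabolicP=> a b ltb lea; rewrite GL_ME mxE big1 // => c _.
by have [ltc|lec] := ltnP c k; [rewrite Pg ?mul0r | rewrite Ph ?mulr0].
Qed.

Canonical parabolic_group (F : finFieldType) (n k : nat) :=
  Group (parabolic_group_set F n k).

Lemma unipotent_group_set (F : finFieldType) (n k : nat) :
  group_set (unipotent F n k).
Proof.
apply/group_setP; split=> [|g h /unipotentP[Pg Ug] /unipotentP[Ph Uh]].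
  by apply/unipotentP; split=> [|a b _]; rewrite ?group1 // GL_1E mxE.
apply/unipotentP; split=> [|a b eab]; first exact: groupM.
rewrite GL_ME mxE (bigD1 a) //= Ug // eqxx mul1r Uh // big1 ?addr0 // => c nca.
have [eac|] := boolP ((a < k)%N == (c < k)%N).
  by rewrite Ug ?(eqP eac) // eq_sym (negPf nca) mul0r.
move/parabolicP: Pg; move/parabolicP: Ph; rewrite eab.
case: (ltnP b k) (ltnP c k) eab => [ltb|leb] [ltc|lec] // eab Ph Pg _.
  by rewrite Ph ?mulr0.
by rewrite Pg ?mul0r // leqNgt eab.
Qed.

Canonical unipotent_group (F : finFieldType) (n k : nat) :=
  Group (unipotent_group_set F n k).

Lemma unipotent_op_group_set (F : finFieldType) (n k : nat) :
  group_set (unipotent_op F n k).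
Proof.
apply/group_setP; split=> [|g h].
  rewrite inE; apply/imsetP; exists 1%g; first exact: group1.
  by rewrite !GL_1E trmx1.
rewrite !inE => /imsetP[u Uu eg] /imsetP[v Uv eh].
apply/imsetP; exists (v * u)%g; first exact: groupM.
by rewrite !GL_ME eg eh -!mulmxE trmx_mul.
Qed.

Canonical unipotent_op_group (F : finFieldType) (n k : nat) :=
  Group (unipotent_op_group_set F n k).

Definition swap_block_mx (R : pzRingType) (a b c : nat) :
    'M[R]_((a + b) + (b + c)) :=
  block_mx (block_mx 1%:M 0 0 0) (block_mx 0 0 1%:M 0)
           (block_mx 0 1%:M 0 0) (block_mx 0 0 0 1%:M).

Lemma swap_block_mx_unit (R : comUnitRingType) (a b c : nat) :
  swap_block_mx R a b c \in unitmx.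
Proof.
suff: swap_block_mx R a b c *m swap_block_mx R a b c = 1%:M.
  by case/mulmx1_unit.
rewrite !mulmx_block !(mul0mx, mulmx0, mul1mx, mulmx1, addr0, add0r).
by rewrite !add_block_mx !(addr0, add0r) !block_mx0 -!scalar_mx_block.
Qed.

(* The permutation matrix p_i.  The defaults in conform_mx and insubd are
   reached only outside the range 0 < n, i <= k <= n - k: see GLval_radon_perm. *)
Definition radon_perm (F : finFieldType) (n k i : nat) : {'GL_n[F]} :=
  insubd (1%g : {'GL_n[F]})
    (conform_mx (1%:M : 'M[F]_n.-1.+1) (swap_block_mx F (k - i) i (n - k - i))).

Lemma radon_perm_dim (n k i : nat) :
  (0 < n)%N -> (i <= k)%N -> (k <= n - k)%N ->
  ((k - i + i) + (i + (n - k - i)) = n.-1.+1)%N.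
Proof.
move=> n0 lik lkn; rewrite subnK // subnKC ?(leq_trans lik) // prednK //.
by rewrite subnKC // (leq_trans lkn) ?leq_subr.
Qed.

Lemma GLval_radon_perm (F : finFieldType) (n k i : nat)
    (n0 : (0 < n)%N) (lik : (i <= k)%N) (lkn : (k <= n - k)%N) :
  GLval (radon_perm F n k i) =
  castmx (radon_perm_dim n0 lik lkn, radon_perm_dim n0 lik lkn)
         (swap_block_mx F (k - i) i (n - k - i)).
Proof.
have conformE m p (e : m = p) (B : 'M[F]_p) (A : 'M[F]_m) :
    conform_mx B A = castmx (e, e) A.
  by case: _ / e B => B; rewrite castmx_id conform_mx_id.
have unit_cast m p (e : m = p) (A : 'M[F]_m) :
    (castmx (e, e) A \in unitmx) = (A \in unitmx).
  by case: _ / e; rewrite castmx_id.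
rewrite /radon_perm (conformE _ _ (radon_perm_dim n0 lik lkn)).
apply: insubdK; have := swap_block_mx_unit F (k - i) i (n - k - i).
by rewrite -(unit_cast _ _ (radon_perm_dim n0 lik lkn)).
Qed.

(* The group algebra C[G] is MathComp's group_ring C G, which realizes it as
   the enveloping algebra of the regular representation: the group element g
   is the matrix regular_repr C G g, and the product of C[G] is *m.          *)

Definition gring_elt (C : fieldType) (gT : finGroupType) (g : gT) :
    'M[C]_#|[set: gT]| :=
  regular_repr C [set: gT] g.

Definition subgroup_idem (C : fieldType) (gT : finGroupType) (H : {group gT}) :
    'M[C]_#|[set: gT]| :=
  #|H|%:R^-1 *: \sum_(h in H) gring_elt C h.

Definition radon_elt (C : fieldType) (F : finFieldType) (n k : nat) :
    'M[C]_#|[set: {'GL_n[F]}]| :=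
  let eU := subgroup_idem C (unipotent_group F n k) in
  let eUop := subgroup_idem C (unipotent_op_group F n k) in
  #|unipotent F n k|%:R ^+ 2 *: (eU *m eUop *m eU).

Definition hecke_elt (C : fieldType) (F : finFieldType) (n k i : nat) :
    'M[C]_#|[set: {'GL_n[F]}]| :=
  let eP := subgroup_idem C (parabolic_group F n k) in
  eP *m gring_elt C (radon_perm F n k i) *m eP.

Definition hecke_basis (C : fieldType) (F : finFieldType) (n k : nat) :
    k.+1.-tuple 'M[C]_#|[set: {'GL_n[F]}]| :=
  [tuple hecke_elt C F n k i | i < k.+1].

(* The coordinates are taken in C[G], on the family e_0, ..., e_k, which is a
   basis of the Hecke algebra e_P C[G] e_P; row i of the matrix holds the
   coordinates of the image of e_i.                                          *)
Definition radon_mx (C : fieldType) (F : finFieldType) (n k : nat) :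
    'M[C]_k.+1 :=
  \matrix_(i, j)
    coord (hecke_basis C F n k) j (hecke_elt C F n k i *m radon_elt C F n k).

(* Main.v *)
Require Import Defs.
From mathcomp Require Import all_boot all_order all_fingroup all_algebra.
From mathcomp Require Import mxrepresentation mxabelem.
From mathcomp Require Import zify ring.

(** Let E be the span of the first k basis vectors, q the order of the field,
    l = n - k, and write the last l rows of g in GL_n as (c d), with c of width
    k and d of width l.  Double cosets of P are classified by the rank of c
    (lemma double_coset), equivalently by the dimension of the meet of E and
    g^-1 E, which is isomorphic to ker c.  Hence e_i is a nonzero multiple of
    the indicator of [rank c = i], and the Hecke algebra is the space of
    functions of x = |ker c|, that is, of polynomials of degree at most k in x.

    Right multiplication by the Radon element averages a P-invariant function
    over U^op, then over U, and multiplies it by |U|^2; in other words it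
    replaces c by c + d y and sums over y, then replaces d by d + c z and sums
    over z.  Each half-step is computed on the function counting s-frames
    (independent s-tuples).  The number of s-frames in a space of x elements is
    the q-falling product
      pi_s(x) = (x - 1)(x - q) ... (x - q^(s-1)).
    Summing the number of s-frames of ker (c + d y) over y counts the pairs
    (v, w) in ker (c d) with v independent, each weighted by the number
    q^((k-s)l) of matrices y with y v = w.  Since ker (c d) has q^k elements, and
    those with v = 0 are the elements of ker d, the sum is
      q^((k-s)l) (q^k - x')(q^k - q x') ... (q^k - q^(s-1) x'),  x' = |ker d|
    (lemma sum_qfalling_pencil).  The product is again a polynomial of degree s,
    now in x', with leading coefficient (-1)^s q^C(s,2); the second half-step is
    the same computation with the roles of c and d exchanged.

    So the Radon transform preserves the degree filtration: in the basis pi_s it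
    is lower triangular, with diagonal entries
      q^((k-s)l) q^((l-s)k) q^(2 C(s,2)),
    which is the announced value for t = k - s.  The matrix in the basis e_i is
    conjugate to this triangular one, because the matrix of the values pi_s(q^d)
    is itself triangular with nonzero diagonal. *)

Set Implicit Arguments.
Unset Strict Implicit.
Unset Printing Implicit Defensive.

Import GRing.Theory Num.Theory.
Local Open Scope ring_scope.

(** * Frames in subspaces over a finite field *)

Section Counting.
Variables (R : comNzRingType) (F : finFieldType).
Local Notation q := (#|F|%:R : R).

Definition indep_mod s m (T : 'M[F]_(s, m)) (N : 'M[F]_m) : bool :=
  \rank (T + N)%MS == (s + \rank N)%N.

Lemma indep_mod_col_mx s m (x : 'rV[F]_m) (T : 'M[F]_(s, m)) (N : 'M[F]_m) :
  indep_mod (col_mx x T) N = indep_mod T N && ~~ (x <= T + N)%MS.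
Proof.
have eqxT : (col_mx x T + N :=: x + (T + N))%MS.
  apply: eqmx_trans (adds_eqmx (eqmx_sym (addsmxE x T)) (eqmx_refl N)) _.
  by rewrite addsmxA.
rewrite /indep_mod eqxT.
have leT : (\rank (T + N) <= s + \rank N)%N.
  by rewrite (leq_trans (mxrank_adds_leqif _ _)) // leq_add2r rank_leq_row.
have [lexT|nlexT] := boolP (x <= T + N)%MS.
  by rewrite andbF (addsmx_idPr lexT); apply/negbTE; rewrite neq_ltn ltnS leT.
have dis : (x :&: (T + N) = 0)%MS.
  apply/eqP; rewrite -mxrank_eq0 -leqn0 -ltnS.
  apply: leq_trans (rank_leq_row x).
  by rewrite (ltn_leqif (mxrank_leqif_sup (capmxSl _ _))) sub_capmx submx_refl.
rewrite (mxrank_disjoint_sum dis) andbT.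
have -> : \rank x = 1%N.
  by rewrite rank_rV; case: eqP nlexT => // ->; rewrite sub0mx.
by rewrite add1n addSn eqSS.
Qed.

(** The modular law gives the meet of K with T + N as T + (K :&: N), and this sum
    is direct since independence modulo N makes T disjoint from N. *)
Lemma rank_cap_adds s m (T : 'M[F]_(s, m)) (K N : 'M[F]_m) :
  (T <= K)%MS -> indep_mod T N ->
  \rank (K :&: (T + N))%MS = (s + \rank (K :&: N))%N.
Proof.
move=> TK /eqP rTN.
have h := mxrank_sum_cap T N; have rT := rank_leq_row T.
have [rTs rTN0] : \rank T = s /\ \rank (T :&: N)%MS = 0%N by lia.
have modular : (T + (K :&: N) :=: K :&: (T + N))%MS.
  by rewrite (capmxC K N) (capmxC K); apply: matrix_modl.
rewrite -modular.
rewrite mxrank_disjoint_sum ?rTs //; apply/eqP; rewrite -mxrank_eq0 -leqn0 -rTN0.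
by rewrite mxrankS ?capmxS ?capmxSr.
Qed.

(** The rows of T are chosen one at a time: after i of them, the vectors of K that
    are forbidden for the next one are those of K :&: (T + N), a subspace of
    dimension i + dim (K :&: N). *)
Lemma card_indep_mod s m (K N : 'M[F]_m) :
  #|[set T : 'M[F]_(s, m) | (T <= K)%MS && indep_mod T N]|%:R =
  \prod_(i < s) (q ^+ \rank K - q ^+ i * q ^+ \rank (K :&: N)%MS).
Proof.
elim: s => [|s IH].
  rewrite big_ord0 (_ : [set _ | _] = setT) ?cardsT ?card_mx ?expn0 //.
  by apply/setP=> T; rewrite !inE (flatmx0 T) sub0mx /indep_mod adds0mx add0n eqxx.
rewrite big_ord_recr -IH /=.
rewrite -[in LHS]sum1_card natr_sum.
rewrite [LHS](eq_bigl (fun T : 'M_(1 + s, m) => (T <= K)%MS && indep_mod T N));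
  last by move=> T; rewrite inE.
rewrite (reindex (fun u : 'M[F]_(s, m) * 'rV[F]_m => col_mx u.2 u.1)) /=;
  last first.
  exists (fun T : 'M_(1 + s, m) => (dsubmx T, usubmx T)) => [[T x] _|T _] /=.
    by rewrite col_mxKu col_mxKd.
  by rewrite vsubmxK.
under eq_bigl => u do rewrite col_mx_sub indep_mod_col_mx.
rewrite (eq_bigl (fun u : 'M_(s, m) * 'rV_m =>
    (u.1 \in [set T : 'M[F]_(s, m) | (T <= K)%MS && indep_mod T N]) &&
    ((u.2 <= K)%MS && ~~ (u.2 <= u.1 + N)%MS))); last first.
  by move=> u; rewrite inE -!andbA; do !bool_congr.
rewrite -(pair_big_dep (fun T => T \in [set T : 'M[F]_(s, m) | _])
   (fun T (x : 'rV_m) => (x <= K)%MS && ~~ (x <= T + N)%MS) (fun _ _ => 1)) /=.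
rewrite -[X in X%:R * _]sum1_card natr_sum mulr_suml.
apply: eq_bigr => T; rewrite inE => /andP[TK TN].
rewrite mul1r sumr_const.
rewrite -exprD -(rank_cap_adds TK TN) -!natrX -!card_rowg /rowg.
rewrite -(cardsID [set u : 'rV_m | (u <= T + N)%MS] [set u | (u <= K)%MS]).
rewrite natrD -(_ : [set u : 'rV_m | (u <= K :&: (T + N))%MS] =
  [set u : 'rV_m | (u <= K)%MS] :&: [set u : 'rV_m | (u <= T + N)%MS]); last first.
  by apply/setP=> u; rewrite !inE sub_capmx.
rewrite [X in X - _]addrC addrK; congr _%:R; apply: eq_card => x.
by rewrite !inE andbC.
Qed.

(** With x the order of a space over F, this counts the independent s-tuples of
    vectors in that space. *)
Definition qfalling (x : R) s : R := \prod_(i < s) (x - q ^+ i).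

Lemma card_kernel_frames s a r (C : 'M[F]_(a, r)) :
  #|[set T : 'M[F]_(s, a) | row_free T && (T *m C == 0)]|%:R =
  qfalling (q ^+ (a - \rank C)) s.
Proof.
have := card_indep_mod s (kermx C) 0; rewrite capmx0 mxrank0 mxrank_ker => cnt.
rewrite /qfalling; under eq_bigr => i _ do rewrite -[q ^+ i]mulr1.
rewrite -cnt; congr _%:R; apply: eq_card => T.
rewrite !inE /indep_mod addsmx0 mxrank0 addn0 andbC; congr (_ && _).
by rewrite sub_kermx.
Qed.

(** Left multiplication by a row-free T is surjective, so its fibres all have the
    same number of elements. *)
Lemma card_solution s a b (T : 'M[F]_(s, a)) (w : 'M[F]_(s, b)) :
  row_free T ->
  #|[set y : 'M[F]_(a, b) | T *m y == w]| = (#|F| ^ ((a - s) * b))%N.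
Proof.
move=> fT; have sa : (s <= a)%N by rewrite -(eqP fT) rank_leq_col.
have fib w' : #|[set y : 'M[F]_(a, b) | T *m y == w']| =
    #|[set y : 'M[F]_(a, b) | T *m y == w]|.
  pose d := pinvmx T *m (w - w').
  have Td : T *m d = w - w' by rewrite mulmxA mulmxVp ?mul1mx.
  rewrite -(card_imset _ (addIr d)) /=; apply: eq_card => y.
  rewrite inE; apply/imsetP/eqP => [[y' + ->]|Ty].
    by rewrite inE => /eqP; rewrite mulmxDr Td => ->; rewrite addrC subrK.
  exists (y - d); last by rewrite subrK.
  by rewrite inE mulmxBr Td Ty opprB addrC subrK.
have cnt : (\sum_(w' : 'M[F]_(s, b))
    #|[set y : 'M[F]_(a, b) | T *m y == w']| = #|F| ^ (a * b))%N.
  rewrite -card_mx -sum1_card (partition_big (fun y => T *m y) xpredT) //=.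
  by apply: eq_bigr => w' _; rewrite sum1dep_card.
move: cnt; under eq_bigr => w' _ do rewrite fib.
rewrite sum_nat_const card_mx => /eqP.
have -> : (a * b = s * b + (a - s) * b)%N by rewrite -mulnDl subnKC.
rewrite expnD eqn_pmul2l; first by move/eqP.
by rewrite expn_gt0 (ltnW (card_finNzRing_gt1 F)).
Qed.

(** A pair (T, w) is an s-tuple of vectors in the left kernel of the stacked
    matrix, and T is row-free exactly when this tuple is independent modulo the
    vectors whose first a coordinates vanish; inside the kernel those form a copy
    of the left kernel of D. *)
Lemma card_pencil_frames s a b r (C : 'M[F]_(a, r)) (D : 'M[F]_(b, r)) :
  \rank (col_mx C D) = r ->
  #|[set u : 'M[F]_(s, a) * 'M[F]_(s, b)
      | row_free u.1 && (u.1 *m C + u.2 *m D == 0)]|%:R =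
  \prod_(i < s) (q ^+ (a + b - r) - q ^+ i * q ^+ (b - \rank D)).
Proof.
move=> rCD.
pose B : 'M[F]_(a + b, a) := col_mx 1%:M 0.
have rB : \rank (kermx B) = b.
  by rewrite mxrank_ker rank_col_mx0 mxrank1 addKn.
have eK : \rank (kermx (col_mx C D)) = (a + b - r)%N by rewrite mxrank_ker rCD.
have eKB : (kermx (col_mx C D) :&: kermx B :=: row_mx (0 : 'M_(b, a)) (kermx D))%MS.
  apply/eqmxP/andP; split; last first.
    rewrite sub_capmx !sub_kermx !mul_row_col !mulmx0 !mul0mx addr0 mulmx_ker.
    by rewrite !addr0 !eqxx.
  set u := (_ :&: _)%MS.
  have : (u <= kermx B)%MS by apply: capmxSr.
  have : (u <= kermx (col_mx C D))%MS by apply: capmxSl.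
  move: u => u; rewrite !sub_kermx -(hsubmxK u) !mul_row_col mulmx0 addr0 mulmx1.
  move=> uCD /eqP u0; move: uCD.
  rewrite u0 mul0mx add0r -sub_kermx => /submxP[X ->].
  by rewrite -[0](mulmx0 _ X) -mul_mx_row submxMl.
have rKB : \rank (kermx (col_mx C D) :&: kermx B)%MS = (b - \rank D)%N.
  by rewrite eKB rank_row_0mx mxrank_ker.
rewrite -rKB -eK -card_indep_mod -!sum1_card; congr _%:R.
rewrite [RHS](reindex (fun u : 'M[F]_(s, a) * 'M[F]_(s, b) => row_mx u.1 u.2)) /=;
  last first.
  exists (fun T : 'M_(s, a + b) => (lsubmx T, rsubmx T)) => [[T w] _|T _] /=.
    by rewrite row_mxKl row_mxKr.
  by rewrite hsubmxK.
apply: eq_bigl => -[T w]; rewrite !inE /= sub_kermx mul_row_col andbC.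
congr (_ && _).
rewrite /indep_mod; have := mxrank_sum_cap (row_mx T w) (kermx B).
have := mxrank_mul_ker (row_mx T w) B.
rewrite mul_row_col mulmx0 mulmx1 addr0 => e1 e2.
by rewrite /row_free; apply/eqP/eqP; lia.
Qed.

(** The half-step of the Radon transform: T (C + y D) = T C + (T y) D, so exchanging
    the sums over y and over frames T and grouping the y by the value w = T y turns
    the sum into a count of pairs (T, w), each with weight q^((a-s)b). *)
Lemma sum_qfalling_pencil s a b r (C : 'M[F]_(a, r)) (D : 'M[F]_(b, r)) :
  \rank (col_mx C D) = r ->
  \sum_(y : 'M[F]_(a, b)) qfalling (q ^+ (a - \rank (C + y *m D)%R)) s =
  q ^+ ((a - s) * b) *
  \prod_(i < s) (q ^+ (a + b - r) - q ^+ i * q ^+ (b - \rank D)).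
Proof.
move=> rCD; rewrite -(card_pencil_frames _ rCD).
under eq_bigr => y _ do rewrite -card_kernel_frames -sum1dep_card natr_sum.
rewrite (exchange_big_dep (fun T : 'M_(s, a) => row_free T)) /=; last first.
  by move=> y T _ /andP[].
rewrite -sum1dep_card natr_sum mulr_sumr.
rewrite -(pair_big_dep (fun T : 'M_(s, a) => row_free T)
   (fun T (w : 'M_(s, b)) => T *m C + w *m D == 0) (fun _ _ => _ * 1)) /=.
apply: eq_bigr => T fT.
under eq_bigl => y do rewrite fT mulmxDr mulmxA /=.
rewrite (partition_big (fun y => T *m y) (fun w => T *m C + w *m D == 0)) /=;
  last by [].
apply: eq_bigr => w /eqP TCw.
rewrite mulr1 -natrX -(card_solution w fT) -sum1dep_card natr_sum.
apply: eq_bigl => y; apply: andb_idl => /eqP ->.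
by rewrite TCw.
Qed.

End Counting.

(** * Expansion in q-falling products *)

Section Coef.
Variables (R : comNzRingType) (F : finFieldType).
Local Notation q := (#|F|%:R : R).

(** The coordinates on the q-falling products of the polynomial
    (Q - x)(Q - q x) ... (Q - q^(s-1) x) in x.  The recursion comes from its last
    factor Q - q^s x and the rule x pi_t = pi_(t+1) + q^t pi_t. *)
Fixpoint frame_coef (Q : R) s t : R :=
  if s is s'.+1 then
    (Q - q ^+ (s' + t)) * frame_coef Q s' t -
    (if t is t'.+1 then q ^+ s' * frame_coef Q s' t' else 0)
  else (t == 0)%:R.

Lemma frame_coef_gt Q s t : (s < t)%N -> frame_coef Q s t = 0.
Proof.
elim: s t => [|s IH] [|t] //= st.
by rewrite !IH ?mulr0 ?subrr // ltnW.
Qed.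

Lemma frame_coef_diag Q s : frame_coef Q s s = (-1) ^+ s * q ^+ 'C(s, 2).
Proof.
elim: s => [|s IH] /=; first by rewrite mul1r.
by rewrite frame_coef_gt // mulr0 add0r IH binS bin1 exprS exprD; ring.
Qed.

Lemma prod_qfalling Q x s N : (s < N)%N ->
  \prod_(i < s) (Q - q ^+ i * x) = \sum_(t < N) frame_coef Q s t * qfalling F x t.
Proof.
elim: s N => [|s IH] N sN.
  case: N sN => // N _; rewrite big_ord0 big_ord_recl /= /qfalling big_ord0.
  rewrite mulr1 big1 ?addr0 // => i _.
  by rewrite mul0r.
rewrite big_ord_recr /=; case: N sN => // N sN.
rewrite (eq_bigr (fun t : 'I_N.+1 =>
  (Q - q ^+ (s + t)) * frame_coef Q s t * qfalling F x t -
  (if t : nat is t'.+1 then q ^+ s * frame_coef Q s t' else 0) * qfalling F x t));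
  last first.
  by move=> t _; rewrite mulrBl.
rewrite sumrB [X in _ = _ - X]big_ord_recl mul0r add0r.
rewrite [X in _ = X - _]big_ord_recr /= [frame_coef _ _ N]frame_coef_gt //.
rewrite mulr0 mul0r addr0.
rewrite -sumrB (IH N) // mulr_suml; apply: eq_bigr => t _.
rewrite /qfalling big_ord_recr /= exprD; ring.
Qed.

Lemma qfalling_small d s : (d < s)%N -> qfalling F (q ^+ d) s = 0.
Proof.
by move=> ds; rewrite /qfalling (bigD1 (Ordinal ds)) //= subrr mul0r.
Qed.
End Coef.

(** * Functions as elements of the group algebra *)

Section GroupRing.
Variables (C : fieldType) (gT : finGroupType).
Implicit Types (f : gT -> C).

Definition gring_sum f : 'M[C]_#|[set: gT]| := \sum_g f g *: gring_elt C g.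

Lemma eq_gring_sum f f' : f =1 f' -> gring_sum f = gring_sum f'.
Proof. by move=> e; apply: eq_bigr => g _; rewrite e. Qed.

Lemma gring_sum_inj f f' : gring_sum f = gring_sum f' -> f =1 f'.
Proof.
have projE f1 g : gring_proj g (gring_sum f1) = (f1 g)%:M.
  rewrite linear_sum /= (bigD1 g) //= linearZ /= gring_projE ?inE // eqxx.
  rewrite big1 => [|h nh]; first by rewrite addr0 scale_scalar_mx mulr1.
  by rewrite linearZ /= gring_projE ?inE // eq_sym (negPf nh) scaler0.
move=> e g; have := congr1 (gring_proj g) e.
by rewrite !projE => /matrixP/(_ 0 0); rewrite !mxE.
Qed.

Lemma gring_sum_lin (I : finType) (c : I -> C) (f : I -> gT -> C) :
  gring_sum (fun g => \sum_i c i * f i g) = \sum_i c i *: gring_sum (f i).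
Proof.
rewrite /gring_sum; under eq_bigr => g _ do rewrite scaler_suml.
rewrite exchange_big /=; apply: eq_bigr => i _; rewrite scaler_sumr.
by apply: eq_bigr => g _; rewrite scalerA.
Qed.

Lemma gring_eltM (g h : gT) : gring_elt C g *m gring_elt C h = gring_elt C (g * h).
Proof. by rewrite /gring_elt repr_mxM ?inE. Qed.

Lemma gring_sum_subgroup (H : {group gT}) f :
  #|H|%:R != 0 :> C ->
  gring_sum f *m (#|H|%:R *: subgroup_idem C H) =
  gring_sum (fun g => \sum_(h in H) f (g * h)%g).
Proof.
move=> H0; rewrite /subgroup_idem scalerA divff // scale1r mulmx_sumr.
rewrite (reindex_inj invg_inj) /= (eq_bigl (mem H));
  last by move=> h /=; rewrite groupV.
rewrite /gring_sum; under [RHS]eq_bigr => g _ do rewrite scaler_suml.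
rewrite [RHS]exchange_big /=; apply: eq_bigr => h _.
rewrite mulmx_suml (reindex_inj (mulIg h)) /=; apply: eq_bigr => g _.
by rewrite -scalemxAl gring_eltM mulgK.
Qed.
End GroupRing.

(** * Block coordinates on the general linear group *)

Section Blocks.
Variables (F : finFieldType) (k l : nat).
Local Notation n := (k.+1 + l)%N.
Local Notation G := {'GL_n[F]}.

(** The size is taken of the form k.+1 + l because 'M_n.-1.+1 is then convertible to
    'M_(k.+1 + l), on which the block operations apply. *)
Definition gmx (g : G) : 'M[F]_(k.+1 + l) := GLval g.
Definition lower_left (g : G) : 'M[F]_(l, k.+1) := dlsubmx (gmx g).
Definition lower_right (g : G) : 'M[F]_l := drsubmx (gmx g).

Lemma gmxM (g h : G) : gmx (g * h)%g = gmx g *m gmx h.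
Proof. by rewrite /gmx GL_ME mulmxE. Qed.

Lemma gmx1 : gmx 1%g = 1%:M.
Proof. by rewrite /gmx GL_1E. Qed.

Lemma gmx_inj : injective gmx.
Proof. exact: val_inj. Qed.

Lemma gmx_unit g : gmx g \in unitmx.
Proof. exact: (valP g). Qed.

Lemma gmx_surj (A : 'M[F]_(k.+1 + l)) : A \in unitmx -> {g : G | gmx g = A}.
Proof.
move=> uA; exists (insubd (1%g : G) (A : 'M[F]_((k.+1+l).-1.+1))).
exact: (insubdK (1%g : G) uA).
Qed.

Lemma parabolicE (g : G) : (g \in parabolic F n k.+1) = (lower_left g == 0).
Proof.
apply/parabolicP/eqP => [h|h a b lta leb].
  apply/matrixP=> i j; rewrite !mxE; apply: h => /=; first exact: ltn_ord.
  exact: leq_addr.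
move/matrixP: h => /(_ (Ordinal (_ : a - k.+1 < l)%N) (Ordinal lta)).
have al : (a - k.+1 < l)%N by rewrite ltn_subLR //; apply: ltn_ord a.
move/(_ al); rewrite !mxE => <-.
by congr (GLval g _ _); apply: val_inj; rewrite /= ?subnKC.
Qed.

Lemma lower_leftM (g h : G) :
  lower_left (g * h)%g =
  lower_left g *m ulsubmx (gmx h) + lower_right g *m lower_left h.
Proof.
rewrite /lower_left /lower_right gmxM -{1}(submxK (gmx g)) -{1}(submxK (gmx h)).
by rewrite mulmx_block block_mxKdl.
Qed.

Lemma lower_rightM (g h : G) :
  lower_right (g * h)%g =
  lower_left g *m ursubmx (gmx h) + lower_right g *m lower_right h.
Proof.
rewrite /lower_left /lower_right gmxM -{1}(submxK (gmx g)) -{1}(submxK (gmx h)).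
by rewrite mulmx_block block_mxKdr.
Qed.

Lemma unipotentE (g : G) :
  (g \in unipotent F n k.+1) = (gmx g == block_mx 1%:M (ursubmx (gmx g)) 0 1%:M).
Proof.
apply/unipotentP/eqP => [[Pg Ug]|e].
  rewrite -{1}(submxK (gmx g)).
  move: Pg; rewrite parabolicE => /eqP; rewrite /lower_left => ->.
  congr block_mx; apply/matrixP=> i j; rewrite !mxE.
    by rewrite Ug /= ?ltn_ord.
  rewrite Ug /= -?(inj_eq val_inj) /= ?eqn_add2l //.
  by rewrite !ltnNge !leq_addr.
split; first by rewrite parabolicE /lower_left e block_mxKdl.
have Ug (a b : 'I_(k.+1 + l)) :
    (a < k.+1)%N = (b < k.+1)%N -> gmx g a b = (a == b)%:R; last exact: Ug.
rewrite e.
case: (split_ordP a) => i ->; case: (split_ordP b) => j ->.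
- by rewrite block_mxEul mxE (inj_eq (@lshift_inj _ _)).
- by [].
- by [].
- by rewrite block_mxEdr mxE (inj_eq (@rshift_inj _ _)).
Qed.

Lemma upper_unit (z : 'M[F]_(k.+1, l)) : block_mx 1%:M z 0 1%:M \in unitmx.
Proof. by rewrite unitmxE det_ublock !det1 mulr1 unitr1. Qed.

Definition upper_uni z : G := sval (gmx_surj (upper_unit z)).

Lemma gmx_upper z : gmx (upper_uni z) = block_mx 1%:M z 0 1%:M.
Proof. exact: (svalP (gmx_surj (upper_unit z))). Qed.

Lemma lower_unit (y : 'M[F]_(l, k.+1)) : block_mx 1%:M 0 y 1%:M \in unitmx.
Proof. by rewrite unitmxE det_lblock !det1 mulr1 unitr1. Qed.

Definition lower_uni y : G := sval (gmx_surj (lower_unit y)).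

Lemma gmx_lower y : gmx (lower_uni y) = block_mx 1%:M 0 y 1%:M.
Proof. exact: (svalP (gmx_surj (lower_unit y))). Qed.

Lemma unipotent_upper z : upper_uni z \in unipotent F n k.+1.
Proof. by rewrite unipotentE gmx_upper block_mxKur. Qed.

Lemma gmx_tr_upper (g : G) z : gmx g = (gmx (upper_uni z))^T -> g = lower_uni z^T.
Proof.
move=> e; apply: gmx_inj; rewrite e gmx_upper gmx_lower tr_block_mx.
by rewrite !trmx1 trmx0.
Qed.

Lemma unipotent_opE (g : G) :
  (g \in unipotent_op F n k.+1) = (gmx g == block_mx 1%:M 0 (dlsubmx (gmx g)) 1%:M).
Proof.
rewrite inE; apply/imsetP/eqP => [[u Uu e]|e].
  have : gmx u = gmx (upper_uni (ursubmx (gmx u))).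
    by rewrite gmx_upper; apply/eqP; rewrite -unipotentE.
  move/gmx_inj => eu; move: e; rewrite eu => /gmx_tr_upper ->.
  by rewrite gmx_lower block_mxKdl.
exists (upper_uni (lower_left g)^T); first exact: unipotent_upper.
have /gmx_inj -> : gmx g = gmx (lower_uni (lower_left g)) by rewrite gmx_lower.
change (gmx (lower_uni (lower_left g)) =
  (gmx (upper_uni (lower_left (lower_uni (lower_left g)))^T))^T).
rewrite gmx_upper tr_block_mx !trmx1 trmx0 trmxK.
by rewrite /lower_left !gmx_lower block_mxKdl.
Qed.

Lemma big_unipotent (T : nmodType) (f : G -> T) :
  \sum_(h in unipotent F n k.+1) f h = \sum_z f (upper_uni z).
Proof.
rewrite (reindex upper_uni) /=; last first.
  exists (fun g => ursubmx (gmx g)) => [z _|g].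
    by rewrite gmx_upper block_mxKur.
  by rewrite unipotentE => /eqP e; apply: gmx_inj; rewrite gmx_upper -e.
by apply: eq_bigl => z; rewrite unipotent_upper.
Qed.

Lemma big_unipotent_op (T : nmodType) (f : G -> T) :
  \sum_(h in unipotent_op F n k.+1) f h = \sum_y f (lower_uni y).
Proof.
rewrite (reindex lower_uni) /=; last first.
  exists lower_left => [z _|g]; first by rewrite /lower_left gmx_lower block_mxKdl.
  by rewrite unipotent_opE => /eqP e; apply: gmx_inj; rewrite gmx_lower -e.
by apply: eq_bigl => z; rewrite unipotent_opE gmx_lower block_mxKdl eqxx.
Qed.

Lemma card_unipotent : #|unipotent F n k.+1| = (#|F| ^ (k.+1 * l))%N.
Proof. by rewrite -sum1_card (big_unipotent (fun=> 1%N)) sum1_card card_mx. Qed.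

Lemma card_unipotent_op : #|unipotent_op F n k.+1| = (#|F| ^ (k.+1 * l))%N.
Proof.
by rewrite -sum1_card (big_unipotent_op (fun=> 1%N)) sum1_card card_mx mulnC.
Qed.

Lemma rank_lower_rows g : \rank (row_mx (lower_left g) (lower_right g)) = l.
Proof.
have -> : row_mx (lower_left g) (lower_right g) = row_mx 0 1%:M *m gmx g.
  rewrite /lower_left /lower_right /dlsubmx /drsubmx hsubmxK -{2}(vsubmxK (gmx g)).
  by rewrite mul_row_col mul0mx mul1mx add0r.
by rewrite mxrankMfree ?row_free_unit ?gmx_unit // rank_row_0mx mxrank1.
Qed.

Variable R : comNzRingType.
Local Notation q := (#|F|%:R : R).

(** The exponents are the dimensions of the right kernels of the blocks, so these
    functions count the s-frames of those kernels. *)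
Definition ll_frames s (g : G) : R :=
  qfalling F (q ^+ (k.+1 - \rank (lower_left g))) s.
Definition lr_frames s (g : G) : R :=
  qfalling F (q ^+ (l - \rank (lower_right g))) s.
Local Notation K := (frame_coef F (q ^+ k.+1)).

(** Right multiplication by an element of U^op adds d y to the lower left block. *)
Lemma sum_ll_frames_lower N s g : (s < N)%N ->
  \sum_y ll_frames s (g * lower_uni y)%g =
  q ^+ ((k.+1 - s) * l) * \sum_(t < N) K s t * lr_frames t g.
Proof.
move=> sN; rewrite -(prod_qfalling F _ _ sN).
have r : \rank (col_mx (lower_left g)^T (lower_right g)^T) = l.
  by rewrite -tr_row_mx mxrank_tr rank_lower_rows.
have := sum_qfalling_pencil R s r; rewrite addnK mxrank_tr => <-.
rewrite [RHS](reindex (@trmx F l k.+1)) /=;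
  last by exists trmx => y _; apply: trmxK.
apply: eq_bigr => y _.
rewrite /ll_frames lower_leftM gmx_lower block_mxKul mulmx1.
rewrite [lower_left (lower_uni _)]/lower_left gmx_lower block_mxKdl.
by rewrite -mxrank_tr linearD /= trmx_mul.
Qed.

(** Right multiplication by an element of U adds c z to the lower right block. *)
Lemma sum_lr_frames_upper N s g : (s < N)%N ->
  \sum_z lr_frames s (g * upper_uni z)%g =
  q ^+ ((l - s) * k.+1) * \sum_(t < N) K s t * ll_frames t g.
Proof.
move=> sN; rewrite -(prod_qfalling F _ _ sN).
have r : \rank (col_mx (lower_right g)^T (lower_left g)^T) = l.
  have := rank_lower_rows g; rewrite -mxrank_tr tr_row_mx => e.
  by rewrite -[RHS]e -!addsmxE addsmxC.
have := sum_qfalling_pencil R s r; rewrite addKn mxrank_tr => <-.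
rewrite [RHS](reindex (@trmx F k.+1 l)) /=;
  last by exists trmx => y _; apply: trmxK.
apply: eq_bigr => y _.
rewrite /lr_frames lower_rightM gmx_upper block_mxKur.
rewrite [lower_right (upper_uni _)]/lower_right gmx_upper block_mxKdr mulmx1.
by rewrite -mxrank_tr linearD /= trmx_mul addrC.
Qed.

End Blocks.

(** * Double cosets of the parabolic subgroup *)

Lemma row_base_of_rank (F : fieldType) m n r (A : 'M[F]_(m, n)) :
  \rank A = r -> exists B : 'M[F]_(r, n), (B :=: A)%MS.
Proof. by case: _ / => //; exists (row_base A); apply: eq_row_base. Qed.

(** Normal form of the row space of X relative to the space E of rows vanishing on
    the first u + v coordinates.  The rows of h are bases of, in this order, a
    complement of X + E, a complement of X :&: E in X, a complement of X :&: E in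
    E, and X :&: E itself.  The last two span E, so h is block upper triangular;
    exchanging the two middle blocks puts a basis of X in the last rows. *)
Lemma adapted_basis (F : fieldType) u v w (X : 'M[F]_(v + w, (u + v) + (v + w))) :
  \rank X = (v + w)%N -> \rank (lsubmx X) = v ->
  exists h : 'M[F]_((u + v) + (v + w)),
    [/\ h \in unitmx, dlsubmx h = 0
      & (X <= dsubmx (swap_block_mx F u v w *m h))%MS].
Proof.
move=> rX rlX.
pose E : 'M[F]_(v + w, (u + v) + (v + w)) := row_mx 0 1%:M.
pose B : 'M[F]_((u + v) + (v + w), u + v) := col_mx 1%:M 0.
have eE : (kermx B :=: E)%MS.
  apply/eqmxP/andP; split;
    last by rewrite sub_kermx mul_row_col mul0mx mulmx0 addr0.
  have : (kermx B <= kermx B)%MS by [].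
  move: {1 3}(kermx B) => t.
  rewrite sub_kermx -(hsubmxK t) mul_row_col mulmx1 mulmx0 addr0.
  move/eqP=> ->; apply/submxP; exists (rsubmx t).
  by rewrite mul_mx_row mulmx0 mulmx1.
have rE : \rank E = (v + w)%N by rewrite rank_row_0mx mxrank1.
have rXE : \rank (X :&: E)%MS = w.
  have := mxrank_mul_ker X B; rewrite (cap_eqmx (eqmx_refl X) eE) rX.
  by rewrite -{1}(hsubmxK X) mul_row_col mulmx1 mulmx0 addr0 rlX => /addnI.
have [B1 e1] := row_base_of_rank rXE.
have [B3 e3] : exists B3 : 'M[F]_(v, (u + v) + (v + w)), (B3 :=: X :\: E)%MS.
  by apply: row_base_of_rank; have := mxrank_cap_compl X E; lia.
have [B2 e2] : exists B2 : 'M[F]_(v, (u + v) + (v + w)), (B2 :=: E :\: X)%MS.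
  by apply: row_base_of_rank; have := mxrank_cap_compl E X; rewrite capmxC; lia.
have [B4 e4] : exists B4 : 'M[F]_(u, (u + v) + (v + w)), (B4 :=: (X + E)^C)%MS.
  by apply: row_base_of_rank; have := mxrank_sum_cap X E; rewrite mxrank_compl; lia.
have sX m (T : 'M_(m, _)) : (B3 <= T)%MS -> (B1 <= T)%MS -> (X <= T)%MS.
  by rewrite e3 e1 -(addsmx_diff_cap_eq X E) addsmx_sub => -> ->.
pose h := col_mx (col_mx B4 B3) (col_mx B2 B1).
have [[h4 h3] [h2 h1]] : ((B4 <= h)%MS /\ (B3 <= h)%MS) /\
    ((B2 <= h)%MS /\ (B1 <= h)%MS).
  have := submx_refl h.
  by rewrite {1}/h !col_mx_sub => /andP[/andP[-> ->] /andP[-> ->]].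
exists h; split.
- rewrite -row_full_unit -sub1mx.
  apply: submx_trans (_ : ((X + E) + (X + E)^C <= h)%MS).
    by apply/submx_full; apply: addsmx_compl_full.
  rewrite !addsmx_sub -e4 h4 sX //= andbT.
  rewrite -(addsmx_diff_cap_eq E X) addsmx_sub -e2 h2 /=.
  by rewrite capmxC -e1.
- have : (dsubmx h <= E)%MS.
    rewrite col_mxKd col_mx_sub e2 e1 capmxSr andbT.
    exact: diffmxSl.
  case/submxP => Y; rewrite /dlsubmx => ->.
  by rewrite mul_mx_row mulmx0 row_mxKl.
rewrite /h /swap_block_mx mul_block_col col_mxKd !mul_block_col.
rewrite !mul0mx !mul1mx !addr0 !add0r add_col_mx addr0 add0r.
by apply: sX; have := submx_refl (col_mx B3 B1); rewrite {1}col_mx_sub => /andP[].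
Qed.

(** The same with the dimensions only propositionally equal to the sums, as they are
    for the permutation matrices p_i. *)
Lemma adapted_basis_cast (F : fieldType) u v w a l (ea : (u + v = a)%N)
    (el : (v + w = l)%N) (e : ((u + v) + (v + w) = a + l)%N)
    (X : 'M[F]_(l, a + l)) :
  \rank X = l -> \rank (lsubmx X) = v ->
  exists h : 'M[F]_(a + l),
    [/\ h \in unitmx, dlsubmx h = 0
      & (X <= dsubmx (castmx (e, e) (swap_block_mx F u v w) *m h))%MS].
Proof.
case: _ / ea e X; case: _ / el => e X.
by rewrite (eq_irrelevance e erefl) castmx_id; apply: adapted_basis.
Qed.

Section Classification.
Variables (F : finFieldType) (k l : nat).
Local Notation n := (k.+1 + l)%N.
Local Notation G := {'GL_n[F]}.
Hypothesis kl : (k.+1 <= l)%N.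
Local Notation p_ i := (radon_perm F n k.+1 i : G).
Local Notation P := (parabolic F n k.+1).

Lemma parabolic_diag_unit (p : G) : p \in P ->
  (ulsubmx (gmx p) \in unitmx) /\ (lower_right p \in unitmx).
Proof.
rewrite parabolicE /lower_left => /eqP p0; have := gmx_unit p.
rewrite -{1}(submxK (gmx p)) p0 !unitmxE det_ublock unitrM => /andP[-> ud].
by split=> //; rewrite unitmxE.
Qed.

Lemma rank_lower_left_parabolic (p g p' : G) : p \in P -> p' \in P ->
  \rank (lower_left (p * g * p')%g) = \rank (lower_left g).
Proof.
move=> Pp Pp'; have [_ ud] := parabolic_diag_unit Pp.
have [uu _] := parabolic_diag_unit Pp'.
move: Pp Pp'; rewrite !parabolicE => /eqP p0 /eqP p0'.
rewrite !lower_leftM p0 p0' mul0mx add0r mulmx0 addr0.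
rewrite mxrankMfree ?row_free_unit //.
by rewrite -mxrank_tr trmx_mul mxrankMfree ?row_free_unit ?unitmx_tr // mxrank_tr.
Qed.

Lemma radon_perm_dims i : (i <= k.+1)%N ->
  [/\ (k.+1 - i + i = k.+1)%N, (i + (n - k.+1 - i) = l)%N
    & ((k.+1 - i + i) + (i + (n - k.+1 - i)) = n)%N].
Proof. by move=> ik; split; lia. Qed.

Lemma gmx_radon_perm i (ik : (i <= k.+1)%N) 
    (e : ((k.+1 - i + i) + (i + (n - k.+1 - i)) = n)%N) :
  gmx (p_ i) = castmx (e, e) (swap_block_mx F (k.+1 - i) i (n - k.+1 - i)).
Proof.
have kln : (k.+1 <= n - k.+1)%N by rewrite addKn.
rewrite /gmx (GLval_radon_perm F (n := n) isT ik kln).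
by congr castmx; congr pair; apply: eq_irrelevance.
Qed.

(** Taking for p' the adapted basis of the last rows of g, these rows lie in the
    span of the last rows of r = p_i p', so the last rows of g r^-1 lie in the span
    of the last coordinate vectors: g r^-1 belongs to P. *)
Lemma double_coset (g : G) i : (i <= k.+1)%N -> \rank (lower_left g) = i ->
  exists2 p, p \in P & exists2 p', p' \in P & g = (p * p_ i * p')%g.
Proof.
move=> ik ri; have [ea el e] := radon_perm_dims ik.
have rX : \rank (dsubmx (gmx g)) = l.
  by rewrite -(hsubmxK (dsubmx _)); apply: rank_lower_rows.
have [h [uh h0]] := adapted_basis_cast ea el e rX ri.
rewrite -(gmx_radon_perm ik); case: (gmx_surj uh) h0 => p' <- p'0 /submxP[Z eZ].
exists (g * (p_ i * p')^-1)%g; last exists p'.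
- pose r := (p_ i * p')%g; rewrite parabolicE -/r.
  have dM (A1 A2 : 'M[F]_(k.+1 + l)) : dsubmx (A1 *m A2) = dsubmx A1 *m A2.
    by rewrite -{1}(vsubmxK A1) mul_col_mx col_mxKd.
  rewrite /lower_left /dlsubmx gmxM dM eZ -gmxM -mulmxA -dM -gmxM mulgV.
  rewrite gmx1 (scalar_mx_block k.+1 l).
  by rewrite col_mxKd mul_mx_row mulmx0 row_mxKl.
- by rewrite parabolicE; apply/eqP.
by rewrite -mulgA mulgKV.
Qed.

Lemma rank_lower_left_radon_perm i : (i <= k.+1)%N -> \rank (lower_left (p_ i)) = i.
Proof.
move=> ik; have [ea el e] := radon_perm_dims ik.
rewrite /lower_left (gmx_radon_perm ik e).
have gen u v w a b (ea' : (u + v = a)%N) (eb : (v + w = b)%N)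
    (e' : ((u + v) + (v + w) = a + b)%N) :
   \rank (@dlsubmx F a b a b (castmx (e', e') (swap_block_mx F u v w))) = v.
  case: _ / ea' e'; case: _ / eb => e'.
  rewrite (eq_irrelevance e' erefl) castmx_id /swap_block_mx block_mxKdl.
  by rewrite /block_mx row_mx0 rank_col_mx0 rank_row_0mx mxrank1.
exact: gen.
Qed.

Lemma rank_lower_left_le (g : G) : (\rank (lower_left g) <= k.+1)%N.
Proof. exact: rank_leq_col. Qed.

(** * The Radon element on the Hecke basis *)

Section Hecke.
Variable C : numClosedFieldType.

(** Up to the factor |P|^2, the coefficient of g in e_i. *)
Definition double_coset_count i (g : G) : C :=
  \sum_(p in P) \sum_(p' in P) ((p * p_ i * p')%g == g)%:R.

Lemma double_coset_count_parabolic i p g p' : p \in P -> p' \in P ->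
  double_coset_count i (p * g * p')%g = double_coset_count i g.
Proof.
move=> Pp Pp'; rewrite /double_coset_count (reindex_inj (mulgI p)) /=.
apply: eq_big => [r|r Pr]; first by rewrite groupMl.
rewrite (reindex_inj (mulIg p')) /=.
apply: eq_big => [r'|r' Pr']; first by rewrite groupMr.
congr (nat_of_bool _)%:R; rewrite !mulgA (inj_eq (mulIg p')).
by rewrite -!mulgA (inj_eq (mulgI p)).
Qed.

Lemma double_coset_count_rank i g : (i <= k.+1)%N ->
  double_coset_count i g =
  (\rank (lower_left g) == i)%:R * double_coset_count i (p_ i).
Proof.
move=> ik; case: eqP => [/(double_coset ik)[p Pp [p' Pp' ->]]|ri].
  by rewrite mul1r double_coset_count_parabolic.
rewrite mul0r /double_coset_count big1 // => p Pp; rewrite big1 // => p' Pp'.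
case: eqP => // e; case: ri.
by rewrite -e rank_lower_left_parabolic // rank_lower_left_radon_perm.
Qed.

Lemma double_coset_count_neq0 i : double_coset_count i (p_ i) != 0.
Proof.
rewrite /double_coset_count; under eq_bigr => p _ do rewrite -natr_sum.
rewrite -natr_sum pnatr_eq0 (bigD1 1%g) ?group1 //= (bigD1 1%g) ?group1 //=.
by rewrite mul1g mulg1 eqxx.
Qed.

(** The common coefficient in e_i of the elements of P p_i P. *)
Definition hecke_weight i : C := #|P|%:R ^- 2 * double_coset_count i (p_ i).

Lemma hecke_weight_neq0 i : hecke_weight i != 0.
Proof.
rewrite mulf_neq0 ?double_coset_count_neq0 // invr_eq0 expf_neq0 //.
by rewrite pnatr_eq0 -lt0n cardG_gt0.
Qed.

Lemma hecke_eltE i : (i <= k.+1)%N ->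
  hecke_elt C F n k.+1 i =
  gring_sum (fun g => hecke_weight i * (\rank (lower_left g) == i)%:R).
Proof.
move=> ik.
rewrite (eq_gring_sum (f' := fun g => #|P|%:R ^- 2 * double_coset_count i g));
  last first.
  move=> g; rewrite (double_coset_count_rank _ ik) /hecke_weight.
  by rewrite -mulrA [_%:R * _]mulrC.
rewrite /hecke_elt /subgroup_idem -!scalemxAl -scalemxAr scalerA -invfM -expr2.
rewrite !mulmx_suml /gring_sum; under [RHS]eq_bigr => g _ do rewrite -scalerA.
rewrite -scaler_sumr; congr (_ *: _).
under [RHS]eq_bigr => g _ do rewrite scaler_suml.
rewrite exchange_big /=; apply: eq_bigr => p _.
under [RHS]eq_bigr => g _ do rewrite scaler_suml.
rewrite exchange_big /= mulmx_sumr; apply: eq_bigr => p' _.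
rewrite !gring_eltM (bigD1 (p * p_ i * p')%g) //= eqxx scale1r big1 ?addr0 //.
by move=> g /negPf; rewrite eq_sym => ->; rewrite scale0r.
Qed.

Local Notation q := (#|F|%:R : C).
Local Notation K := (frame_coef F (q ^+ k.+1)).
Local Notation ll_frames := (@ll_frames F k l C).
Local Notation lr_frames := (@lr_frames F k l C).

Lemma ll_frames_hecke s :
  gring_sum (ll_frames s) =
  \sum_(j < k.+2) (qfalling F (q ^+ (k.+1 - j)) s / hecke_weight j) *:
     tnth (hecke_basis C F n k.+1) j.
Proof.
under eq_bigr => j _ do rewrite tnth_mktuple hecke_eltE ?leq_ord // .
rewrite -gring_sum_lin; apply: eq_gring_sum => g.
rewrite (bigD1 (Ordinal (rank_lower_left_le g : (_ < k.+2)%N))) //= eqxx mulr1.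
rewrite divfK ?hecke_weight_neq0 //.
rewrite big1 ?addr0 // => j; rewrite -(inj_eq val_inj) /= eq_sym => /negPf ->.
by rewrite !mulr0.
Qed.

(** The e_i are nonzero and have disjoint supports. *)
Lemma hecke_basis_free : free (hecke_basis C F n k.+1).
Proof.
apply/freeP => c.
have -> : \sum_(j < k.+2) c j *: (hecke_basis C F n k.+1)`_j =
   gring_sum (fun g => \sum_(j < k.+2)
     c j * (hecke_weight j * (\rank (lower_left g) == j)%:R)).
  rewrite gring_sum_lin; apply: eq_bigr => j _.
  by rewrite -tnth_nth tnth_mktuple hecke_eltE ?leq_ord.
have <- : gring_sum (fun _ : G => 0 : C) = 0.
  by rewrite /gring_sum big1 // => g _; rewrite scale0r.
move/gring_sum_inj => e j; have := e (p_ j).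
rewrite (rank_lower_left_radon_perm (leq_ord j)) (bigD1 j) //= eqxx mulr1.
rewrite big1 ?addr0.
  by move/eqP; rewrite mulf_eq0 (negPf (hecke_weight_neq0 j)) orbF => /eqP.
by move=> i; rewrite -(inj_eq val_inj) /= eq_sym => /negPf ->; rewrite !mulr0.
Qed.

Lemma ll_frames_parabolic s (g p : G) :
  p \in P -> ll_frames s (g * p)%g = ll_frames s g.
Proof.
move=> Pp; rewrite /ll_frames -[(g * p)%g]mul1g mulgA.
by rewrite rank_lower_left_parabolic ?group1.
Qed.

(** The composite of the two half-steps, read in the family ll_frames. *)
Definition radon_coef s r : C := q ^+ ((k.+1 - s) * l) *
  \sum_(t < k.+2) K s t * (q ^+ ((l - t) * k.+1) * K t r).

(** The first factor e_U fixes a right P-invariant function; the factors |U| e_U^op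
    and |U| e_U are the two half-steps. *)
Lemma ll_frames_radon s : (s < k.+2)%N ->
  gring_sum (ll_frames s) *m radon_elt C F n k.+1 =
  \sum_(r < k.+2) radon_coef s r *: gring_sum (ll_frames r).
Proof.
move=> sk; pose U := unipotent_group F n k.+1.
pose U' := unipotent_op_group F n k.+1.
have cU : #|U|%:R != 0 :> C by rewrite pnatr_eq0 -lt0n cardG_gt0.
have cU' : #|U'|%:R != 0 :> C by rewrite pnatr_eq0 -lt0n cardG_gt0.
have eUU' : #|U'|%:R = #|U|%:R :> C by rewrite card_unipotent card_unipotent_op.
have inv1 : gring_sum (ll_frames s) *m (#|U|%:R *: subgroup_idem C U) =
    #|U|%:R *: gring_sum (ll_frames s).
  rewrite gring_sum_subgroup // /gring_sum scaler_sumr; apply: eq_bigr => g _.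
  rewrite scalerA; congr (_ *: _); rewrite mulr_natl -sumr_const.
  by apply: eq_bigr => h /unipotentP[Ph _]; rewrite ll_frames_parabolic.
have inv : gring_sum (ll_frames s) *m subgroup_idem C U = gring_sum (ll_frames s).
  by apply: (scalerI cU); rewrite scalemxAr.
have -> : radon_elt C F n k.+1 =
  subgroup_idem C U *m (#|U'|%:R *: subgroup_idem C U') *m
  (#|U|%:R *: subgroup_idem C U).
  rewrite /radon_elt -/U -/U' eUU'.
  move: (subgroup_idem C U) (subgroup_idem C U') => e e'.
  by rewrite -!scalemxAr -scalemxAl scalerA -expr2.
rewrite !mulmxA inv gring_sum_subgroup //.
have -> : gring_sum (fun g => \sum_(h in U') ll_frames s (g * h)%g) =
   \sum_(t < k.+2) (q ^+ ((k.+1 - s) * l) * K s t) *: gring_sum (lr_frames t).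
  rewrite -gring_sum_lin; apply: eq_gring_sum => g; rewrite big_unipotent_op.
  rewrite (sum_ll_frames_lower _ _ sk) mulr_sumr.
  by apply: eq_bigr => t _; rewrite mulrA.
rewrite mulmx_suml.
under eq_bigr => t _.
  rewrite -scalemxAl gring_sum_subgroup //.
  rewrite (_ : gring_sum _ =
      \sum_(r < k.+2) (q ^+ ((l - t) * k.+1) * K t r) *: gring_sum (ll_frames r)).
    over.
  rewrite -gring_sum_lin; apply: eq_gring_sum => g; rewrite big_unipotent.
  rewrite (sum_lr_frames_upper _ _ (ltn_ord t)) mulr_sumr.
  by apply: eq_bigr => r _; rewrite mulrA.
under eq_bigr => t _ do rewrite scaler_sumr.
rewrite exchange_big /=; apply: eq_bigr => r _.
rewrite /radon_coef mulr_sumr scaler_suml.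
by apply: eq_bigr => t _; rewrite scalerA !mulrA.
Qed.
End Hecke.
End Classification.

(** * The spectrum *)

Lemma eigenvalue_conj (C : fieldType) n (Q A : 'M[C]_n) (a : C) : Q \in unitmx ->
  eigenvalue (invmx Q *m A *m Q) a = eigenvalue A a.
Proof.
move=> uQ; apply/eigenvalueP/eigenvalueP => -[v va v0].
  exists (v *m invmx Q); last by rewrite mulmx_free_eq0 ?row_free_unit ?unitmx_inv.
  by rewrite scalemxAl -va -!mulmxA mulmxV // mulmx1.
exists (v *m Q); last by rewrite mulmx_free_eq0 ?row_free_unit.
by rewrite -!mulmxA (mulKVmx uQ) mulmxA va -scalemxAl.
Qed.

Lemma eigenvalue_trig (C : fieldType) n (A : 'M[C]_n) (a : C) :
  is_trig_mx A -> eigenvalue A a <-> exists i, a = A i i.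
Proof.
move=> tA; rewrite eigenvalue_root_char char_poly_trig // rootE horner_prod.
split=> [/prodf_eq0[i _]|[i ->]].
  by rewrite hornerXsubC subr_eq0 => /eqP ->; exists i.
by apply/eqP/eqP/prodf_eq0; exists i; rewrite ?hornerXsubC ?subrr.
Qed.

Lemma radon_exponent a l s t : (s + t = a)%N -> (0 < a)%N -> (a <= l)%N ->
  ((a - s) * l + ((l - s) * a + 2 * 'C(s, 2)) =
   a * l - a + (a + l - 2 * a + 1) * t + t ^ 2)%N.
Proof.
move=> <- st0 /subnKC; move: (l - (s + t))%N => m <-.
rewrite mul_bin_left bin1.
have -> : (s + t + m - s = t + m)%N by lia.
have -> : (s + t - s = t)%N by lia.
have -> : (s + t + (s + t + m) - 2 * (s + t) = m)%N by lia.
have -> : ((s + t) * (s + t + m) - (s + t) = (s + t) * (s + t + m).-1)%N by nia.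
by case: s st0 => [|s] st0; nia.
Qed.

Section Spectrum.
Variables (F : finFieldType) (k l : nat) (C : numClosedFieldType).
Hypothesis kl : (k.+1 <= l)%N.
Local Notation n := (k.+1 + l)%N.
Local Notation q := (#|F|%:R : C).

Definition frames_mx : 'M[C]_k.+2 :=
  \matrix_(s, j) (qfalling F (q ^+ (k.+1 - j)) s / hecke_weight F k l C j).

Definition radon_frames_mx : 'M[C]_k.+2 := \matrix_(s, r) radon_coef F k l C s r.

(** Up to reversing the order of the columns and scaling them, this is the matrix of
    values pi_s(q^d), which vanish for d < s. *)
Lemma frames_mx_unit : frames_mx \in unitmx.
Proof.
pose S : 'M[C]_k.+2 :=
  \matrix_(s, d) (qfalling F (q ^+ d) s / hecke_weight F k l C (rev_ord d)).
have -> : frames_mx = col_perm (perm (@rev_ord_inj k.+2)) S.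
  by apply/matrixP=> s j; rewrite !mxE permE rev_ordK /= subSS.
rewrite col_permE unitmx_mul unitmx_perm andbT unitmxE -det_tr det_trig; last first.
  by apply/is_trig_mxP => i j ij; rewrite !mxE qfalling_small ?mul0r.
rewrite unitfE; apply/prodf_neq0 => i _.
rewrite !mxE mulf_neq0 ?invr_eq0 ?hecke_weight_neq0 //.
apply/prodf_neq0 => j _; rewrite subr_eq0.
by rewrite -!natrX eqr_nat eqn_exp2l ?card_finNzRing_gt1 // gtn_eqF.
Qed.

Lemma radon_mx_conj :
  radon_mx C F n k.+1 = invmx frames_mx *m radon_frames_mx *m frames_mx.
Proof.
pose f (s : 'I_k.+2) := gring_sum (@ll_frames F k l C s).
pose X := hecke_basis C F n k.+1.
have fX s : f s = \sum_j frames_mx s j *: X`_j.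
  rewrite /f ll_frames_hecke //; apply: eq_bigr => j _; rewrite !mxE.
  by rewrite (tnth_nth 0).
have Xf (i : 'I_k.+2) : X`_i = \sum_s invmx frames_mx i s *: f s.
  under eq_bigr => s _ do rewrite fX scaler_sumr.
  rewrite exchange_big /=.
  under eq_bigr => j _.
    under eq_bigr => s _ do rewrite scalerA.
    rewrite -scaler_suml.
    rewrite (_ : \sum_s _ = (1%:M : 'M[C]_k.+2) i j).
      over.
    by rewrite -(mulVmx frames_mx_unit) mxE.
  rewrite (bigD1 i) //= mxE eqxx scale1r big1 ?addr0 // => j.
  by rewrite mxE eq_sym => /negPf ->; rewrite scale0r.
apply/matrixP=> i j; rewrite mxE.
have -> : hecke_elt C F n k.+1 i = X`_i by rewrite -tnth_nth tnth_mktuple.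
rewrite Xf mulmx_suml.
have -> : \sum_s (invmx frames_mx i s *: f s) *m radon_elt C F n k.+1 =
  \sum_j (invmx frames_mx *m radon_frames_mx *m frames_mx) i j *: X`_j.
  under eq_bigr => s _.
    rewrite -scalemxAl ll_frames_radon // scaler_sumr.
    under eq_bigr => r _ do rewrite scalerA -/(f r) .
    over.
  rewrite exchange_big /=.
  under eq_bigr => r _ do rewrite -scaler_suml fX scaler_sumr.
  rewrite exchange_big /=; apply: eq_bigr => t _; rewrite !mxE scaler_suml.
  apply: eq_bigr => r _; rewrite scalerA; congr (_ * _ *: _).
  by rewrite mxE; apply: eq_bigr => s _; rewrite !mxE.
by rewrite coord_sum_free // hecke_basis_free.
Qed.

(** Neither half-step raises the degree. *)
Lemma radon_frames_trig : is_trig_mx radon_frames_mx.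
Proof.
apply/is_trig_mxP => s r sr; rewrite mxE /radon_coef big1 ?mulr0 // => t _.
have [st|ts] := ltnP s t; first by rewrite frame_coef_gt ?mul0r.
by rewrite [frame_coef _ _ _ r]frame_coef_gt ?mulr0 // (leq_ltn_trans ts).
Qed.

Lemma radon_frames_diag (s : 'I_k.+2) :
  radon_frames_mx s s =
  q ^+ (k.+1 * l - k.+1 + (n - 2 * k.+1 + 1) * (k.+1 - s) + (k.+1 - s) ^ 2)%N.
Proof.
have sk : (s <= k.+1)%N := leq_ord s.
rewrite -(radon_exponent (subnKC sk)) // mxE /radon_coef (bigD1 s) //=.
rewrite big1 ?addr0; last first.
  move=> t; rewrite -(inj_eq val_inj) neq_ltn => /orP[ts|st].
    by rewrite [frame_coef _ _ t s]frame_coef_gt ?mulr0.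
  by rewrite frame_coef_gt ?mul0r.
rewrite frame_coef_diag mul2n -addnn !exprD.
(* The signs of the two leading coefficients cancel. *)
have cancel_sign (u v w x : C) : x ^+ 2 = 1 ->
    u * (x * w * (v * (x * w))) = u * (v * (w * w)).
  move=> x2; transitivity (x ^+ 2 * (u * (v * (w * w)))); first by ring.
  by rewrite x2 mul1r.
exact/cancel_sign/sqrr_sign.
Qed.

End Spectrum.

Theorem proposition7p9 (C : numClosedFieldType) (F : finFieldType) (n k : nat)
    (hk : (1 <= k)%N) (hkn : (k <= n - k)%N) (a : C) :
  eigenvalue (radon_mx C F n k) a <->
  exists2 t : nat, (t <= k)%N &
    a = #|F|%:R ^+ (k * (n - k) - k + (n - 2 * k + 1) * t + t ^ 2)%N.
Proof.
case: k hk hkn => // k _ hkn.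
have [l en] : exists l, n = (k.+1 + l)%N.
  by exists (n - k.+1)%N; rewrite subnKC //; lia.
move: hkn; rewrite {n}en addKn => kl.
rewrite radon_mx_conj // eigenvalue_conj ?frames_mx_unit //.
rewrite eigenvalue_trig ?radon_frames_trig //.
split=> [[s ->]|[t tk ->]].
  by exists (k.+1 - s)%N; rewrite ?leq_subr // radon_frames_diag.
have sk : (k.+1 - t < k.+2)%N by rewrite ltnS leq_subr.
by exists (Ordinal sk); rewrite radon_frames_diag //= subKn.
Qed.
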